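(* Let $k$ be a field and let $G$ be a quiver. The following statements are equivalent: (a) the path coalgebra $PC(G)$ is prime; (b) $G$ is strongly connected.
   Context: A quiver $G=(V,E,s,t)$ consists of sets $V$ (vertices) and $E$ (arrows) and maps $s,t:E\to V$ (source and tail). A path is a finite sequence of arrows $p=x_1\cdots x_n$ with $t(x_i)=s(x_{i+1})$; $s(p)=s(x_1)$, $t(p)=t(x_n)$. Vertices are paths of length $0$, with $s(a)=t(a)=a$; concatenation with a trivial path at the appropriate end leaves a path unchanged. $G$ is strongly connected if for each two vertices $a$ and $b$ there is a path in $G$ with source $a$ and tail $b$. The path coalgebra $PC(G)$ is the $k$-vector space with basis the set of all paths, with $\Delta(p)=\sum_{p_1p_2=p}p_1\otimes p_2$ (sum over all ways of writing $p$ as a concatenation, so $\Delta(a)=a\otimes a$ for a vertex $a$), $\varepsilon(a)=1$ for vertices $a$ and $\varepsilon(p)=0$ for paths of positive length. For subcoalgebras $A,B$ of a coalgebra $C$, the wedge is $A\wedge^C B=\Delta^{-1}(C\otimes B+A\otimes C)$. A coalgebra $C$ is prime if for any subcoalgebras $A,B$ of $C$ with $C=A\wedge^C B$, either $C=A$ or $C=B$. *)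

(* Defs.v *)
From HB Require Import structures.
From mathcomp Require Import all_boot all_algebra.
From mathcomp Require Import freeg boolp classical_sets.

Set Implicit Arguments.
Unset Strict Implicit.
Unset Printing Implicit Defensive.

Import GRing.Theory.
Local Open Scope classical_set_scope.
Local Open Scope ring_scope.
Local Open Scope quotient_scope.

Reserved Notation "u \ox v" (at level 40, left associativity).

Section Span.
Variables (k : fieldType) (V : lmodType k).

Definition subspace (A : set V) : Prop := submod_closed (mem A).

Definition span (X : set V) : set V := smallest subspace X.

Lemma subspaceP (A : set V) :
  subspace A <-> A 0 /\ forall a u v, A u -> A v -> A (a *: u + v).
Proof.
split=> [[A0 AD]|[A0 AD]]; split.
- by move: A0; rewrite inE.
- move=> a u v Au Av.
  by have := AD a u v; rewrite !inE; apply.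
- by rewrite inE.
- by move=> a u v; rewrite !inE; apply: AD.
Qed.

Lemma sub_span (X : set V) : X `<=` span X.
Proof. exact: sub_smallest. Qed.

Lemma span_subspace (X : set V) : subspace (span X).
Proof.
apply/subspaceP; split=> [W [/subspaceP[W0 _] _] //|a u v Xu Xv W WX].
have [/subspaceP[_ WD] _] := WX.
by apply: WD; [apply: Xu | apply: Xv].
Qed.

Lemma span_min (X W : set V) : subspace W -> X `<=` W -> span X `<=` W.
Proof. by move=> sW XW; apply: smallest_sub. Qed.

End Span.

Section FreeLift.
Variables (k : fieldType) (M : lmodType k) (K : choiceType) (f : K -> M).

Lemma fglift_linear : linear (fglift f : {freeg K / k} -> M).
Proof.
have fgB : zmod_morphism (fglift f : {freeg K / k} -> M).
  exact: lift_is_additive.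
pose F : {additive {freeg K / k} -> M} :=
  HB.pack (fglift f) (GRing.isZmodMorphism.Build _ _ (fglift f) fgB).
move=> a x y.
suff Fz z : F (a *: z) = a *: F z by rewrite -[fglift f]/(F : _ -> _) raddfD Fz.
have FU b i : F << b *g i >> = b *: f i by rewrite /= liftU.
have -> : a *: z = \sum_(x <- dom z) << a * coeff x z *g x >> by [].
have -> : F z = F (\sum_(x <- dom z) << coeff x z *g x >>) by rewrite freeg_sumE.
rewrite !raddf_sum.
by apply: eq_bigr => i _; rewrite !FU; apply: esym; apply: scalerA.
Qed.

HB.instance Definition _ :=
  GRing.isLinear.Build k {freeg K / k} M *:%R (fglift f) fglift_linear.

End FreeLift.

Section FreeLiftTheory.
Variables (k : fieldType) (M : lmodType k) (K : choiceType).

Lemma freeg_linear_eq (g h : {freeg K / k} -> M) :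
  linear g -> linear h -> (forall x, g << x >> = h << x >>) -> g =1 h.
Proof.
move=> gl hl gh z; rewrite -(freeg_sumE z).
have l0 (f : {freeg K / k} -> M) : linear f -> f 0 = 0.
  by move=> fl; have := fl (-1) 0 0; rewrite scaleN1r addNr scaleN1r addNr.
elim: (dom z) => [|i s IH]; first by rewrite big_nil !l0.
rewrite big_cons.
have -> : << coeff i z *g i >> = coeff i z *: << i >>.
  by apply/eqP/freeg_eqP => j; rewrite coeffZ !coeffU mul1r.
by rewrite gl hl gh IH.
Qed.

Lemma fglift_fun_linear (f g : K -> M) a z :
  fglift (fun x => a *: f x + g x) z = a *: fglift f z + fglift g z.
Proof.
move: z; apply: freeg_linear_eq => [|b y z|x]; first exact: fglift_linear.
  rewrite !fglift_linear !scalerDr !scalerA mulrC !addrA; congr (_ + _).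
  by rewrite -!addrA; congr (_ + _); rewrite addrC.
by rewrite !liftU !scale1r.
Qed.

End FreeLiftTheory.

(* The tensor product over [k]: the free vector space on [U * V] modulo the
   relations of bilinearity. *)
Section Tensor.
Variables (k : fieldType) (U V : lmodType k).

Local Notation free := {freeg (U * V) / k}.

Definition tensor_relations : set free :=
  [set r | (exists a u u' v,
       r = << (a *: u + u', v) >> - (a *: << (u, v) >> + << (u', v) >>)) \/
     (exists a u v v',
       r = << (u, a *: v + v') >> - (a *: << (u, v) >> + << (u, v') >>))].

Definition tensor_null : {pred free} := mem (span tensor_relations).

Lemma tensor_null_zmod : zmod_closed tensor_null.
Proof. exact: GRing.submod_closedB (span_subspace tensor_relations). Qed.

HB.instance Definition _ :=
  GRing.isZmodClosed.Build free tensor_null tensor_null_zmod.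

Lemma tensor_nullZ a x : x \in tensor_null -> a *: x \in tensor_null.
Proof.
have [S0 SD] := span_subspace tensor_relations.
by move=> Nx; rewrite -[_ *: _]addr0; apply: SD.
Qed.

Definition tensor : Type := (Quotient.quot tensor_null).

HB.instance Definition _ := Choice.on tensor.
HB.instance Definition _ := GRing.Zmodule.on tensor.
HB.instance Definition _ := Quotient.on tensor.

Let pi_t : free -> tensor := \pi_(Quotient.quot tensor_null).

Let pi_tB : {morph pi_t : x y / x - y}.
Proof. exact: (raddfB (\pi_(Quotient.quot tensor_null))). Qed.

Let pi_tD : {morph pi_t : x y / x + y}.
Proof. exact: (raddfD (\pi_(Quotient.quot tensor_null))). Qed.

Let pi_t_eq x y : x - y \in tensor_null -> pi_t x = pi_t y.
Proof. by rewrite Quotient.idealrBE => /eqP. Qed.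

Let pi_t_inj x y : pi_t x = pi_t y -> x - y \in tensor_null.
Proof. by rewrite Quotient.idealrBE => /eqP. Qed.

Let pi_reprK (t : tensor) : pi_t (repr t) = t.
Proof. exact: reprK. Qed.

Definition tensor_scale (a : k) (t : tensor) : tensor :=
  \pi_(Quotient.quot tensor_null) (a *: repr t).

Let pi_tZ a x : pi_t (a *: x) = tensor_scale a (pi_t x).
Proof.
apply: pi_t_eq; rewrite -scalerBr; apply/tensor_nullZ/pi_t_inj.
by rewrite pi_reprK.
Qed.

Lemma tensor_scaleA a b t :
  tensor_scale a (tensor_scale b t) = tensor_scale (a * b) t.
Proof. by rewrite -[t]pi_reprK -!pi_tZ scalerA. Qed.

Lemma tensor_scale1 : left_id 1 tensor_scale.
Proof. by move=> t; rewrite -[t]pi_reprK -!pi_tZ scale1r. Qed.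

Lemma tensor_scaleDr : right_distributive tensor_scale +%R.
Proof.
by move=> a t u; rewrite -[t]pi_reprK -[u]pi_reprK -pi_tD -!pi_tZ scalerDr pi_tD.
Qed.

Lemma tensor_scaleDl t : {morph tensor_scale^~ t : a b / a + b}.
Proof. by move=> a b; rewrite -[t]pi_reprK -!pi_tZ scalerDl pi_tD. Qed.

HB.instance Definition _ := GRing.Zmodule_isLmodule.Build k tensor
  tensor_scaleA tensor_scale1 tensor_scaleDr tensor_scaleDl.

Definition tens (u : U) (v : V) : tensor := \pi_(Quotient.quot tensor_null) << (u, v) >>.

Let pi_t_linear a x y : pi_t (a *: x + y) = a *: pi_t x + pi_t y.
Proof. by rewrite pi_tD pi_tZ. Qed.

Lemma tensPl a u u' v : tens (a *: u + u') v = a *: tens u v + tens u' v.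
Proof.
apply: etrans (pi_t_linear _ _ _); apply: pi_t_eq.
by rewrite inE; apply: sub_span; left; exists a, u, u', v.
Qed.

Lemma tensPr u a v v' : tens u (a *: v + v') = a *: tens u v + tens u v'.
Proof.
apply: etrans (pi_t_linear _ _ _); apply: pi_t_eq.
by rewrite inE; apply: sub_span; right; exists a, u, v, v'.
Qed.

Definition is_bilinear (W : lmodType k) (f : U -> V -> W) : Prop :=
  (forall v, linear (f^~ v)) /\ (forall u, linear (f u)).

(* The linear map on the tensor product sending [tens u v] to [f u v];
   meaningful only for bilinear [f]. *)
Definition tlift (W : lmodType k) (f : U -> V -> W) (t : tensor) : W :=
  fglift (fun uv => f uv.1 uv.2) (repr t).

Section Lift.
Variables (W : lmodType k) (f : U -> V -> W) (f_bil : is_bilinear f).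

Let F : free -> W := fglift (fun uv => f uv.1 uv.2).

Let F_lin a x y : F (a *: x + y) = a *: F x + F y.
Proof. exact: fglift_linear. Qed.

Let F_B x y : F (x - y) = F x - F y.
Proof.
have -> : x - y = - 1 *: y + x by rewrite scaleN1r addrC.
by rewrite F_lin scaleN1r addrC.
Qed.

Let F_U x : F << x >> = f x.1 x.2.
Proof. by rewrite /F liftU scale1r. Qed.

Let F_null x : x \in tensor_null -> F x = 0.
Proof.
rewrite inE; move: x; apply: span_min.
  apply/subspaceP; split=> [|a u v /= Fu Fv].
    by have := F_B 0 0; rewrite !subrr.
  by rewrite F_lin Fu Fv scaler0 addr0.
have [fl fr] := f_bil.
by move=> x [[a [u [u' [v ->]]]]|[a [u [v [v' ->]]]]] /=;
  rewrite F_B F_lin !F_U /= ?fl ?fr subrr.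
Qed.

Let tlift_pi x : tlift f (pi_t x) = F x.
Proof.
apply/eqP; rewrite -subr_eq0 -F_B; apply/eqP/F_null.
by apply: pi_t_inj; rewrite pi_reprK.
Qed.

Lemma tlift_linear : linear (tlift f).
Proof.
move=> a t u; rewrite -[t]pi_reprK -[u]pi_reprK.
by rewrite -pi_t_linear !tlift_pi F_lin.
Qed.

Lemma tliftE u v : tlift f (tens u v) = f u v.
Proof. by rewrite tlift_pi F_U. Qed.

End Lift.

Lemma tensor_spanned (W : set tensor) :
  subspace W -> (forall u v, W (tens u v)) -> forall t, W t.
Proof.
move=> /subspaceP[W0 WD] Wt t; rewrite -[t]pi_reprK.
rewrite -(freeg_sumE (repr t)); elim: (dom _) => [|x s IH].
  by rewrite big_nil (_ : pi_t 0 = 0) //; apply: (raddf0 (\pi_(Quotient.quot tensor_null))).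
rewrite big_cons pi_tD.
have -> : << coeff x (repr t) *g x >> = coeff x (repr t) *: << x >>.
  by apply/eqP/freeg_eqP => j; rewrite coeffZ !coeffU mul1r.
by rewrite pi_tZ; apply: WD => //; case: x.
Qed.

End Tensor.

Notation "u \ox v" := (tens u v) : ring_scope.

(* For subspaces [A] of [U] and [B] of [V], the subspace of [tensor U V] that is
   identified with the tensor product of [A] and [B]. *)
Definition tensor_set (k : fieldType) (U V : lmodType k) (A : set U) (B : set V)
    : set (tensor U V) :=
  span [set x \ox y | x in A & y in B].

Definition tensor_assoc (k : fieldType) (U V W : lmodType k) :
    tensor (tensor U V) W -> tensor U (tensor V W) :=
  tlift (fun t w => tlift (fun u v => u \ox (v \ox w)) t).

Section TensorTheory.
Variable k : fieldType.

Lemma tlift_fun_linear (U V W : lmodType k) (f g : U -> V -> W) a t :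
  tlift (fun u v => a *: f u v + g u v) t = a *: tlift f t + tlift g t.
Proof. exact: (fglift_fun_linear (fun uv => f uv.1 uv.2)). Qed.

Lemma linear0_fun (U W : lmodType k) (f : U -> W) : linear f -> f 0 = 0.
Proof.
by move=> fl; have := fl (-1) 0 0; rewrite scaleN1r addNr scaleN1r addNr.
Qed.

Lemma linear_sum_fun (U W : lmodType k) (f : U -> W) I (s : seq I) (F : I -> U) :
  linear f -> f (\sum_(i <- s) F i) = \sum_(i <- s) f (F i).
Proof.
move=> fl; elim: s => [|i s IH]; first by rewrite !big_nil linear0_fun.
by rewrite !big_cons -[F i]scale1r fl IH !scale1r.
Qed.

Lemma tlift_sum (U V W : lmodType k) (f : U -> V -> W) I (s : seq I)
    (F : I -> U) (H : I -> V) : is_bilinear f ->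
  tlift f (\sum_(i <- s) F i \ox H i) = \sum_(i <- s) f (F i) (H i).
Proof.
move=> fb; rewrite linear_sum_fun; last exact: tlift_linear.
by apply: eq_bigr => i _; rewrite tliftE.
Qed.

Lemma tens_suml (U V : lmodType k) I (s : seq I) (F : I -> U) (v : V) :
  (\sum_(i <- s) F i) \ox v = \sum_(i <- s) F i \ox v.
Proof. by apply: (@linear_sum_fun _ _ (fun u => u \ox v)) => a x y; apply: tensPl. Qed.

Lemma tens_sumr (U V : lmodType k) I (s : seq I) (u : U) (F : I -> V) :
  u \ox (\sum_(i <- s) F i) = \sum_(i <- s) u \ox F i.
Proof. by apply: (@linear_sum_fun _ _ (fun v => u \ox v)) => a x y; apply: tensPr. Qed.

Lemma tens_bilinear (U V U' V' : lmodType k) (f : U' -> U) (g : V' -> V) :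
  linear f -> linear g -> is_bilinear (fun x y => f x \ox g y).
Proof. by move=> fl gl; split=> ? a x y; rewrite ?fl ?gl ?tensPl ?tensPr. Qed.

Lemma assoc_bilinear (U V W : lmodType k) (w : W) :
  is_bilinear (fun (u : U) (v : V) => u \ox (v \ox w)).
Proof. by split=> ? a x y; rewrite !(tensPl, tensPr). Qed.

Lemma tensor_assoc_bilinear (U V W : lmodType k) :
  is_bilinear (fun (t : tensor U V) (w : W) =>
    tlift (fun u v => u \ox (v \ox w)) t).
Proof.
split=> [w|t a x y]; first exact: (tlift_linear (assoc_bilinear U V w)).
rewrite -tlift_fun_linear; congr (tlift _ t).
by apply/funext => u; apply/funext => v; rewrite !tensPr.
Qed.

Lemma tensor_assoc_linear (U V W : lmodType k) : linear (@tensor_assoc k U V W).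
Proof. exact: (tlift_linear (tensor_assoc_bilinear U V W)). Qed.

Lemma tensor_assocE (U V W : lmodType k) (u : U) (v : V) (w : W) :
  tensor_assoc ((u \ox v) \ox w) = u \ox (v \ox w).
Proof.
rewrite /tensor_assoc tliftE; last exact: tensor_assoc_bilinear.
by rewrite tliftE //; apply: assoc_bilinear.
Qed.

End TensorTheory.

Record coalgebra (k : fieldType) := Coalgebra {
  carrier :> lmodType k;
  comul : {linear carrier -> tensor carrier carrier};
  counit : {linear carrier -> k^o};
  comulA : forall c,
    tensor_assoc (tlift (fun x y => comul x \ox y) (comul c)) =
    tlift (fun x y => x \ox comul y) (comul c);
  counitl : forall c, tlift (fun x y => (counit x : k) *: y) (comul c) = c;
  counitr : forall c, tlift (fun x y => (counit y : k) *: x) (comul c) = c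
}.

Section Prime.
Variables (k : fieldType) (C : coalgebra k).

Definition subcoalgebra (A : set C) : Prop :=
  subspace A /\ forall c, A c -> tensor_set A A (comul C c).

Definition wedge (A B : set C) : set C :=
  comul C @^-1`
    [set x + y | x in tensor_set [set: C] B & y in tensor_set A [set: C]].

Definition prime_coalgebra : Prop :=
  forall A B : set C, subcoalgebra A -> subcoalgebra B ->
    [set: C] = wedge A B -> [set: C] = A \/ [set: C] = B.

End Prime.

Record quiver := Quiver {
  vertex : choiceType;
  arrow : choiceType;
  src : arrow -> vertex;
  tgt : arrow -> vertex
}.

Section Path.
Variable G : quiver.

Fixpoint chain (a : vertex G) (xs : seq (arrow G)) : bool :=
  if xs is x :: xs' then (src x == a) && chain (tgt x) xs' else true.

Definition chain_end (a : vertex G) (xs : seq (arrow G)) : vertex G :=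
  last a (map (@tgt G) xs).

(* A path is stored with its source, so that [(a, [::])] is the trivial path at
   the vertex [a]; a nonempty sequence of arrows determines its source. *)
Record qpath := QPath {
  qpath_val : vertex G * seq (arrow G);
  qpathP : chain qpath_val.1 qpath_val.2
}.

HB.instance Definition _ := [isSub for qpath_val].
HB.instance Definition _ := [Choice of qpath by <:].

Definition psrc (p : qpath) : vertex G := (val p).1.
Definition arrows (p : qpath) : seq (arrow G) := (val p).2.
Definition ptgt (p : qpath) : vertex G := chain_end (psrc p) (arrows p).
Definition plength (p : qpath) : nat := size (arrows p).

Definition is_concat (p1 p2 p : qpath) : bool :=
  [&& ptgt p1 == psrc p2, psrc p == psrc p1 & arrows p == arrows p1 ++ arrows p2].

Lemma chain_cat a xs ys :
  chain a (xs ++ ys) = chain a xs && chain (chain_end a xs) ys.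
Proof. by elim: xs a => //= x xs IH a; rewrite IH andbA. Qed.

Lemma chain_end_cat a xs ys :
  chain_end a (xs ++ ys) = chain_end (chain_end a xs) ys.
Proof. by rewrite /chain_end map_cat last_cat. Qed.

Lemma prefix_proof (p : qpath) i : chain (psrc p) (take i (arrows p)).
Proof.
by have := qpathP p; rewrite -{1}(cat_take_drop i (qpath_val p).2) chain_cat => /andP[].
Qed.

Lemma suffix_proof (p : qpath) i :
  chain (chain_end (psrc p) (take i (arrows p))) (drop i (arrows p)).
Proof.
by have := qpathP p; rewrite -{1}(cat_take_drop i (qpath_val p).2) chain_cat => /andP[].
Qed.

Definition prefix_path (p : qpath) (i : nat) : qpath :=
  @QPath (_, _) (prefix_proof p i).
Definition suffix_path (p : qpath) (i : nat) : qpath :=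
  @QPath (_, _) (suffix_proof p i).

Definition splits (p : qpath) : seq (qpath * qpath) :=
  [seq (prefix_path p i, suffix_path p i) | i <- index_iota 0 (plength p).+1].

Lemma mem_splits p p1 p2 : ((p1, p2) \in splits p) = is_concat p1 p2 p.
Proof.
apply/mapP/and3P => [[i _ [-> ->]]|[/eqP e1 /eqP e2 /eqP e3]].
  by split; rewrite // /arrows /= cat_take_drop.
exists (plength p1).
  by rewrite mem_index_iota ltnS /plength e3 size_cat leq_addr.
congr (_, _); apply: val_inj; rewrite /= e2 e3 take_size_cat //.
  exact: surjective_pairing.
rewrite drop_size_cat // -/(ptgt p1) e1; exact: surjective_pairing.
Qed.

Lemma splits_uniq p : uniq (splits p).
Proof.
rewrite map_inj_in_uniq ?iota_uniq // => i j.
rewrite !mem_index_iota !ltnS /= => ip jp [/(congr1 size) + _ _].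
by rewrite !size_takel.
Qed.

Definition strongly_connected : Prop :=
  forall a b : vertex G, exists p : qpath, psrc p = a /\ ptgt p = b.

Lemma prefix_prefix p i j :
  (i <= j)%N -> prefix_path (prefix_path p j) i = prefix_path p i.
Proof.
by move=> ij; apply: val_inj; rewrite /= /psrc /arrows /= take_takel.
Qed.

Lemma suffix_prefix p i j : (i <= j)%N ->
  suffix_path (prefix_path p j) i = prefix_path (suffix_path p i) (j - i).
Proof.
move=> ij; apply: val_inj; rewrite /= /psrc /arrows /= take_takel //.
by rewrite take_drop subnK.
Qed.

Lemma suffix_suffix p i j : (i <= j)%N ->
  suffix_path (suffix_path p i) (j - i) = suffix_path p j.
Proof.
move=> ij; apply: val_inj; rewrite /= /psrc /arrows /= drop_drop subnK //.
by rewrite -chain_end_cat take_drop subnK // -{1}(take_takel _ ij) cat_take_drop.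
Qed.

End Path.

Section PathCoalgebra.
Variables (k : fieldType) (G : quiver).

Local Notation PC := {freeg (qpath G) / k}.

Definition path_comul : PC -> tensor PC PC :=
  fglift (fun p => \sum_(q <- splits p) << q.1 >> \ox << q.2 >>).

Definition path_counit : PC -> k^o :=
  fglift (fun p => if plength p == 0%N then 1 else 0).

HB.instance Definition _ := GRing.Linear.on path_comul.
HB.instance Definition _ := GRing.Linear.on path_counit.

Lemma path_comulE p :
  path_comul << p >> = \sum_(q <- splits p) << q.1 >> \ox << q.2 >>.
Proof. by rewrite /path_comul liftU scale1r. Qed.

Lemma path_counitE p : path_counit << p >> = if plength p == 0%N then 1 else 0.
Proof. by rewrite /path_counit liftU; apply: mul1r. Qed.

Let id_linear (V : lmodType k) : linear (@id V). Proof. by []. Qed.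

Let comul_linear : linear path_comul. Proof. exact: fglift_linear. Qed.

Lemma path_comulA c :
  tensor_assoc (tlift (fun x y => path_comul x \ox y) (path_comul c)) =
  tlift (fun x y => x \ox path_comul y) (path_comul c).
Proof.
have bl : is_bilinear (fun x y : PC => path_comul x \ox y).
  exact: (tens_bilinear comul_linear (@id_linear _)).
have br : is_bilinear (fun x y : PC => x \ox path_comul y).
  exact: (tens_bilinear (@id_linear _) comul_linear).
move: c; apply: freeg_linear_eq => [a x y|a x y|p].
- by rewrite comul_linear (tlift_linear bl); apply: tensor_assoc_linear.
- by rewrite comul_linear (tlift_linear br).
rewrite path_comulE (tlift_sum _ _ _ bl) (tlift_sum _ _ _ br).
rewrite linear_sum_fun; last exact: tensor_assoc_linear.
rewrite !big_map /=; set n := plength p.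
pose T i j : tensor PC (tensor PC PC) := << prefix_path p i >> \ox
  (<< prefix_path (suffix_path p i) (j - i) >> \ox << suffix_path p j >>).
transitivity (\sum_(0 <= j < n.+1) \sum_(0 <= i < n.+1 | (i <= j)%N) T i j).
  apply: eq_big_nat => j /andP[_ jn].
  rewrite path_comulE tens_suml linear_sum_fun; last exact: tensor_assoc_linear.
  rewrite big_map /= (big_nat_widen _ _ n.+1); last first.
    by rewrite ltnS /plength size_take; case: ifP => // _; apply: leq_trans jn.
  have -> : plength (prefix_path p j) = j by rewrite /plength size_takel.
  rewrite big_nat_cond [RHS]big_nat_cond; apply: eq_big => [i|i /andP[_ ij]].
    by rewrite ltnS.
  rewrite tensor_assocE prefix_prefix; last by rewrite -ltnS.
  by rewrite suffix_prefix //; rewrite -ltnS.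
rewrite (exchange_big_dep_nat xpredT) //=; apply: eq_big_nat => i /andP[_ i_n].
rewrite path_comulE tens_sumr big_map /=.
have -> : plength (suffix_path p i) = (n - i)%N by rewrite /plength size_drop.
rewrite -(big_nat_widenl i 0 _ xpredT) //= -subSn // -{1}[i]add0n big_addn.
apply: eq_bigr => j _; rewrite /T addnK.
have <- // : suffix_path (suffix_path p i) j = suffix_path p (j + i).
by rewrite -{1}(addnK i j) suffix_suffix // leq_addl.
Qed.

Let scale_bilinear : is_bilinear (fun x y : PC => (path_counit x : k) *: y).
Proof.
split=> [v a x y|u a x y]; rewrite /path_counit.
  by rewrite fglift_linear scalerDl scalerA.
by rewrite scalerDr !scalerA mulrC.
Qed.

Let scale_bilinear' : is_bilinear (fun x y : PC => (path_counit y : k) *: x).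
Proof. by have [l r] := scale_bilinear; split=> ?; [apply: r | apply: l]. Qed.

Lemma path_counitl c :
  tlift (fun x y => (path_counit x : k) *: y) (path_comul c) = c.
Proof.
move: c; apply: freeg_linear_eq => [a x y|//|p].
  by rewrite comul_linear (tlift_linear scale_bilinear).
rewrite path_comulE (tlift_sum _ _ _ scale_bilinear) big_map big_nat_recl //= path_counitE /=.
have -> : plength (prefix_path p 0) = 0%N by rewrite /plength size_takel.
rewrite eqxx scale1r big1_seq ?addr0 => [|i].
  congr << _ >>; apply: val_inj; rewrite /= take0 drop0.
  by apply: esym; apply: surjective_pairing.
move=> /andP[_]; rewrite mem_index_iota => /andP[_ ip].
by rewrite path_counitE /plength size_takel // scale0r.
Qed.

Lemma path_counitr c :
  tlift (fun x y => (path_counit y : k) *: x) (path_comul c) = c.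
Proof.
move: c; apply: freeg_linear_eq => [a x y|//|p].
  by rewrite comul_linear (tlift_linear scale_bilinear').
rewrite path_comulE (tlift_sum _ _ _ scale_bilinear') big_map big_nat_recr //= path_counitE /=.
have -> : plength (suffix_path p (plength p)) = 0%N.
  by rewrite /plength size_drop subnn.
rewrite eqxx scale1r big1_seq ?add0r => [|i].
  congr << _ >>; apply: val_inj; rewrite /= take_size.
  by apply: esym; apply: surjective_pairing.
move=> /andP[_]; rewrite mem_index_iota => /andP[_ ip].
by rewrite path_counitE /plength size_drop subn_eq0 leqNgt ip scale0r.
Qed.

Definition path_coalgebra : coalgebra k :=
  @Coalgebra k PC path_comul path_counit path_comulA path_counitl path_counitr.

End PathCoalgebra.

(* Main.v *)
(* If [b] is not reachable from [a], let [A] be spanned by the paths ending at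
   a vertex not reachable from [a], and [B] by the paths starting at a vertex
   reachable from [a]. Whenever a path splits as [p1 p2], either [p1] lies in [A]
   or [p2] lies in [B], so [PC] is the wedge of [A] and [B]; the trivial path at
   [a] is not in [A] and the one at [b] is not in [B].

   Conversely, let [A] and [B] be proper, [p] a shortest path outside [A], [q] a
   shortest path outside [B], and [r] a path from the target of [p] to the source
   of [q]. Choose functionals [f] with [f A = 0] and [f p = 1], and [g] with
   [g B = 0] and [g q = 1], and let [h] be the coefficient at [r]. By minimality
   of [p] and [q] the only splitting of the path [p r q] contributing to
   [f * h * g] is the obvious one, so this convolution is [1] there. But [h * g]
   vanishes on [B], hence [f * (h * g)] vanishes on the wedge of [A] and [B]. *)

Require Import Defs.
From mathcomp Require Import all_boot all_algebra.
From mathcomp Require Import freeg boolp classical_sets zify.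

Set Implicit Arguments.
Unset Strict Implicit.
Unset Printing Implicit Defensive.

Import Defs GRing.Theory.
Local Open Scope classical_set_scope.
Local Open Scope ring_scope.

Lemma sum_nat_only1 (V : nmodType) n i (F : nat -> V) : (i < n)%N ->
  (forall j, (j < n)%N -> j != i -> F j = 0) -> \sum_(0 <= j < n) F j = F i.
Proof.
move=> i_n F0; rewrite (bigD1_seq i) ?iota_uniq ?mem_index_iota //=.
rewrite big1_seq ?addr0 // => j /andP[ji]; rewrite mem_index_iota => jn.
exact: F0.
Qed.

(** * Subspaces and separating functionals *)

Section Subspace.
Variables (k : fieldType) (V : lmodType k).
Implicit Types A B : set V.

Lemma subspace_sum A I (s : seq I) (F : I -> V) :
  subspace A -> (forall i, A (F i)) -> A (\sum_(i <- s) F i).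
Proof.
move=> /subspaceP[A0 AD] AF; elim: s => [|i s IH]; first by rewrite big_nil.
by rewrite big_cons -[F i]scale1r; apply: AD.
Qed.

Lemma subspaceD A B :
  subspace A -> subspace B -> subspace [set x + y | x in A & y in B].
Proof.
move=> /subspaceP[A0 AD] /subspaceP[B0 BD]; apply/subspaceP; split.
  by exists 0 => //; exists 0; rewrite ?addr0.
move=> a _ _ [x Ax [y By <-]] [x' Ax' [y' By' <-]].
exists (a *: x + x'); first exact: AD.
exists (a *: y + y'); first exact: BD.
by rewrite scalerDr addrACA.
Qed.

Lemma subspace_preimage (W : lmodType k) (f : V -> W) (B : set W) :
  linear f -> subspace B -> subspace (f @^-1` B).
Proof.
move=> fl /subspaceP[B0 BD]; apply/subspaceP; split=> [|a u v Bu Bv] /=.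
  by rewrite linear0_fun.
by rewrite fl; apply: BD.
Qed.

Lemma subspace0 : subspace [set 0 : V].
Proof.
by apply/subspaceP; split=> [//|a u v /= -> ->]; rewrite scaler0 addr0.
Qed.

(** Zorn's lemma on the subspaces through [A] that avoid [v]. Maximality will make [M] a complement
    of the line through [v], which replaces completing a basis. *)
Lemma maximal_subspace A v : subspace A -> ~ A v ->
  exists M, [/\ subspace M, A `<=` M, ~ M v &
    forall N, subspace N -> M `<=` N -> ~ N v -> N `<=` M].
Proof.
move=> sA Av.
(* The union with [A] makes the union of the empty chain admissible. *)
pose P X := subspace (X `|` A) /\ ~ (X `|` A) v.
have [F FP chF|X [[sX Xv] Xmax]] := @Zorn_bigcup V P.
  split; last by case=> [[X FX Xv]|//]; have [_] := FP X FX; apply; left.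
  have [A0 AD] := (subspaceP A).1 sA.
  apply/subspaceP; split=> [|a x y]; first by right.
  (* One member of the chain, joined with [A], is enough: the larger of two members contains both
     vectors. *)
  have FD X u w : F X -> (X `|` A) u -> (X `|` A) w ->
      (\bigcup_(X in F) X `|` A) (a *: u + w).
    move=> FX Xu Xw; have [/subspaceP[_ XD] _] := FP X FX.
    by have [Xuw|Auw] := XD a _ _ Xu Xw; [left; exists X | right].
  move=> [[X FX Xx]|Ax] [[Y FY Yy]|Ay].
  - have [XY|YX] := chF X Y FX FY.
      by apply: (FD Y _ _ FY); left=> //; apply: XY.
    by apply: (FD X _ _ FX); left=> //; apply: YX.
  - by apply: (FD X _ _ FX (or_introl Xx) (or_intror Ay)).
  - by apply: (FD Y _ _ FY (or_intror Ax) (or_introl Yy)).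
  - by right; apply: AD.
exists (X `|` A); split=> // N sN XN Nv x Nx.
apply: contrapT => Xx; apply: (Xmax N).
  split=> [y Xy|NX]; first by apply: XN; left.
  by apply: Xx; left; apply: NX.
by rewrite /P (_ : N `|` A = N) //; apply/setUidPl => y Ay; apply: XN; right.
Qed.

(** The functional is the coordinate along [v] modulo a maximal subspace [M] avoiding [v]. *)
Lemma separating_functional A v : subspace A -> ~ A v ->
  exists f : V -> k^o, [/\ linear f, forall x, A x -> f x = 0 & f v = 1].
Proof.
move=> sA /(maximal_subspace sA)[M [sM AM Mv Mmax]].
have [M0 MD] := (subspaceP M).1 sM.
have MZ a x : M x -> M (a *: x) by move=> Mx; rewrite -[_ *: _]addr0; apply: MD.
have MB x y : M x -> M y -> M (x - y).
  by move=> Mx My; rewrite addrC -scaleN1r; apply: MD.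
have line x : exists c : k, M (x - c *: v).
  apply: contrapT => /forallNP xM.
  (* [N] is [M + k x]. If it contained [v], solving for [x] would put [x] in [M + k v]; if it avoids
     [v], maximality puts [x] in [M]. Both contradict [xM]. *)
  pose N := [set y | exists c : k, M (y - c *: x)].
  suff NM : N `<=` M.
    apply: (xM 0); rewrite scale0r subr0; apply: NM.
    by exists 1; rewrite scale1r subrr.
  apply: Mmax => [|y My|[c Mc]].
  - apply/subspaceP; split=> [|a y z [c Mc] [d Md]].
      by exists 0; rewrite scale0r subr0.
    exists (a * c + d); have := MD a _ _ Mc Md.
    by rewrite scalerBr addrACA -opprD scalerA -scalerDl.
  - by exists 0; rewrite scale0r subr0.
  have [c0|c0] := eqVneq c 0.
    by apply: Mv; move: Mc; rewrite c0 scale0r subr0.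
  apply: (xM c^-1); have /(MZ (- c^-1)) := Mc.
  by rewrite scalerBr scalerA mulNr mulVf // scaleN1r opprK scaleNr addrC.
(* Uniqueness of the coordinate makes the pointwise choice [f] linear and fixes its values. *)
have uniq_coord x c d : M (x - c *: v) -> M (x - d *: v) -> c = d.
  move=> Mc Md; apply: contrapT => /eqP; rewrite -subr_eq0 => cd; apply: Mv.
  have := MZ (c - d)^-1 _ (MB _ _ Md Mc).
  have -> : x - d *: v - (x - c *: v) = (c - d) *: v.
    by rewrite opprB addrC -addrA addKr scalerBl.
  by rewrite scalerA mulVf // scale1r.
have [f fP] := choice line.
exists f; split=> [a x y|x Ax|].
- apply: (uniq_coord (a *: x + y)) => //; have := MD a _ _ (fP x) (fP y).
  by rewrite scalerBr addrACA -opprD scalerA -scalerDl.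
- by apply: (uniq_coord x) => //; rewrite scale0r subr0; apply: AM.
- by apply: (uniq_coord v) => //; rewrite scale1r subrr.
Qed.

End Subspace.

(** * Bilinear maps on tensor products of subspaces *)

Section TensorSet.
Variables (k : fieldType) (U V : lmodType k).

Lemma tensor_setT (A : set U) (B : set V) u v :
  A u -> B v -> tensor_set A B (u \ox v).
Proof. by move=> Au Bv; apply: sub_span; exists u => //; exists v. Qed.

Lemma tlift_eq0 (W : lmodType k) (f : U -> V -> W) (A : set U) (B : set V) t :
  is_bilinear f -> (forall u v, A u -> B v -> f u v = 0) ->
  tensor_set A B t -> tlift f t = 0.
Proof.
move=> fb f0; move: t; apply: span_min => [|_ [u Au [v Bv <-]]] /=.
  exact: (subspace_preimage (tlift_linear fb) (@subspace0 _ _)).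
by rewrite tliftE // f0.
Qed.

Lemma mul_bilinear (f : U -> k^o) (g : V -> k^o) :
  linear f -> linear g -> is_bilinear (fun u v => f u * g v : k^o).
Proof.
move=> fl gl; split=> [v a x y|u a x y].
  by rewrite fl mulrDl scalerAl.
by rewrite gl mulrDr scalerAr.
Qed.

End TensorSet.

(** * Convolution of functionals *)

Section Convolution.
Variables (k : fieldType) (C : coalgebra k).
Implicit Types f g : C -> k^o.

Definition convolution f g (c : C) : k^o :=
  tlift (fun x y => f x * g y : k^o) (comul C c).

Lemma convolution_linear f g : linear f -> linear g -> linear (convolution f g).
Proof.
move=> fl gl a x y.
by rewrite /convolution linearP (tlift_linear (mul_bilinear fl gl)).
Qed.

(** The right tensor factors of [comul C c] stay in [B], where [g] vanishes. *)
Lemma convolution_eq0r f g (B : set C) : linear f -> linear g ->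
  subcoalgebra B -> (forall c, B c -> g c = 0) ->
  forall c, B c -> convolution f g c = 0.
Proof.
move=> fl gl [_ BB] g0 c /BB; apply: (tlift_eq0 (mul_bilinear fl gl)).
by move=> x y _ By; rewrite (g0 y By) mulr0.
Qed.

(** The summand in [C] tensor [B] is killed by [g], the one in [A] tensor [C] by [f]. *)
Lemma convolution_wedge_eq0 f g (A B : set C) : linear f -> linear g ->
  (forall c, A c -> f c = 0) -> (forall c, B c -> g c = 0) ->
  forall c, wedge A B c -> convolution f g c = 0.
Proof.
move=> fl gl f0 g0 c [t tB [u uA tu]].
have fgb := mul_bilinear fl gl.
rewrite /convolution -tu -[t]scale1r (tlift_linear fgb).
rewrite (tlift_eq0 fgb _ tB) => [|x y _ By]; last by rewrite (g0 y By) mulr0.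
rewrite (tlift_eq0 fgb _ uA) => [|x y Ax _]; last by rewrite (f0 x Ax) mul0r.
by rewrite scaler0 addr0.
Qed.

End Convolution.

(** * Subspaces of a free vector space *)

Section Freeg.
Variables (k : fieldType) (K : choiceType).
Local Notation F := {freeg K / k}.

Lemma subspace_freegT (W : set F) :
  subspace W -> (forall x, W << x >>) -> W = [set: F].
Proof.
move=> sW WU; apply/seteqP; split=> // z _; rewrite -(freeg_sumE z).
apply: subspace_sum => // x; have [W0 WD] := (subspaceP W).1 sW.
have -> : << coeff x z *g x >> = coeff x z *: << x >> + 0 :> F.
  by rewrite addr0; apply/eqP/freeg_eqP => j; rewrite coeffZ !coeffU mul1r.
exact: WD.
Qed.

(** If [P x] failed, the coefficient at [x] would vanish on all generators, but it is 1 at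
    [<< x >>]. *)
Lemma span_freegU (P : K -> Prop) x :
  span [set (<< y >> : F) | y in P] << x >> -> P x.
Proof.
move=> Px; apply: contrapT => nPx.
suff : [set z : F | coeff x z = 0] << x >>.
  by rewrite /= coeffU eqxx mulr1 => /eqP; rewrite oner_eq0.
apply: span_min Px => [|_ [y Py <-]] /=.
  apply/subspaceP; split=> [|a u v /= u0 v0]; first exact: coeff0.
  by rewrite coeffD coeffZ u0 v0 mulr0 addr0.
rewrite coeffU; case: eqP => [yx|]; last by rewrite mulr0.
by case: nPx; rewrite -yx.
Qed.

End Freeg.

(** * Paths and the two implications *)

Section Paths.
Variables (k : fieldType) (G : quiver).
Local Notation PC := (path_coalgebra k G).
Implicit Types p q r : qpath G.

Lemma ptgt_prefix p i : ptgt (prefix_path p i) = psrc (suffix_path p i).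
Proof. by []. Qed.

Lemma ptgt_suffix p i : ptgt (suffix_path p i) = ptgt p.
Proof. by rewrite /ptgt /psrc /arrows /= -chain_end_cat cat_take_drop. Qed.

Lemma plength_prefix p i : (i <= plength p)%N -> plength (prefix_path p i) = i.
Proof. by move=> ip; rewrite /plength size_takel. Qed.

Lemma plength_suffix p i : plength (suffix_path p i) = (plength p - i)%N.
Proof. by rewrite /plength size_drop. Qed.

Definition path_span (P : qpath G -> Prop) : set PC :=
  span [set << p >> | p in P].

Lemma path_spanU (P : qpath G -> Prop) p : P p -> path_span P << p >>.
Proof. by move=> Pp; apply: sub_span; exists p. Qed.

Lemma comul_path p :
  comul PC << p >> = \sum_(0 <= i < (plength p).+1)
    << prefix_path p i >> \ox << suffix_path p i >>.
Proof. by rewrite /= path_comulE big_map. Qed.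

Lemma path_span_subcoalgebra (P : qpath G -> Prop) :
  (forall p i, P p -> P (prefix_path p i) /\ P (suffix_path p i)) ->
  subcoalgebra (path_span P).
Proof.
move=> Psub; split; first exact: span_subspace.
apply: span_min => [|_ [p Pp <-]].
  by apply: (subspace_preimage (linearP (comul PC))); apply: span_subspace.
rewrite comul_path; apply: (subspace_sum _ (span_subspace _)) => i.
by have [? ?] := Psub p i Pp; apply: tensor_setT; apply: path_spanU.
Qed.

Lemma convolution_path (f g : PC -> k^o) p : linear f -> linear g ->
  convolution f g << p >> = \sum_(0 <= i < (plength p).+1)
    f << prefix_path p i >> * g << suffix_path p i >>.
Proof.
move=> fl gl; rewrite /convolution comul_path.
by rewrite (tlift_sum _ _ _ (mul_bilinear fl gl)).
Qed.

(** Paths span, so a proper subspace misses one of them. *)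
Lemma shortest_path_notin (A : set PC) : subspace A -> A <> [set: PC] ->
  exists2 p, ~ A << p >> &
    forall q, (plength q < plength p)%N -> A << q >>.
Proof.
move=> sA AT.
have ex : exists n, `[< exists2 p, ~ A << p >> & plength p = n >].
  apply: contrapT => nex; apply: AT; apply: subspace_freegT => // p.
  apply: contrapT => Ap; apply: nex; exists (plength p).
  by apply/asboolP; exists p.
case: (ex_minnP ex) => n /asboolP[p Ap <-] pmin; exists p => // q qp.
apply: contrapT => Aq; have := pmin (plength q).
by rewrite leqNgt qp => h; have : false by apply: h; apply/asboolP; exists q.
Qed.

(** The second cut is made on the suffix after [p], matching the nesting of [f * (h * g)]. *)
Lemma join_paths p r q : ptgt p = psrc r -> ptgt r = psrc q ->
  exists2 w, plength w = (plength p + plength r + plength q)%N &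
    [/\ prefix_path w (plength p) = p,
        prefix_path (suffix_path w (plength p)) (plength r) = r &
        suffix_path (suffix_path w (plength p)) (plength r) = q].
Proof.
move=> pr rq.
have wP : chain (psrc p) (arrows p ++ arrows r ++ arrows q).
  rewrite !chain_cat -[chain_end (psrc p) _]/(ptgt p) pr.
  rewrite -[chain_end (psrc r) _]/(ptgt r) rq.
  by rewrite (qpathP p) (qpathP r) (qpathP q).
exists (@QPath _ (_, _) wP); first by rewrite /plength /arrows /= !size_cat addnA.
split; apply: val_inj; rewrite /= /psrc /arrows /= ?take_size_cat //
  ?drop_size_cat ?take_size_cat // [RHS]surjective_pairing //; congr (_, _).
  exact: pr.
by apply: etrans rq; congr chain_end; exact: pr.
Qed.

Definition reachable (a b : vertex G) : Prop :=
  exists p : qpath G, psrc p = a /\ ptgt p = b.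

Lemma reachable_ptgt a p : reachable a (psrc p) -> reachable a (ptgt p).
Proof.
move=> [q [qa qp]].
have wP : chain (psrc q) (arrows q ++ arrows p).
  by rewrite chain_cat -[chain_end _ _]/(ptgt q) qp (qpathP q) (qpathP p).
exists (@QPath _ (_, _) wP); split=> //.
by rewrite /ptgt /psrc /arrows /= chain_end_cat -/(arrows q) -/(psrc q) -/(ptgt q) qp.
Qed.

Lemma prime_strongly_connected :
  prime_coalgebra PC -> strongly_connected G.
Proof.
move=> primeC a b; apply: contrapT => nab.
pose A := path_span (fun p => ~ reachable a (ptgt p)).
pose B := path_span (fun p => reachable a (psrc p)).
have sA : subcoalgebra A.
  (* Were the end of the prefix reachable, following the suffix would reach the end of [p]. *)
  apply: path_span_subcoalgebra => p i nap; split; last by rewrite ptgt_suffix.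
  by rewrite ptgt_prefix => /reachable_ptgt; rewrite ptgt_suffix.
have sB : subcoalgebra B.
  apply: path_span_subcoalgebra => p i ap; split=> //.
  by rewrite -ptgt_prefix; apply: reachable_ptgt.
have wAB : [set: PC] = wedge A B.
  have sD := subspaceD (span_subspace [set x \ox y | x in [set: PC] & y in B])
                       (span_subspace [set x \ox y | x in A & y in [set: PC]]).
  apply/esym/subspace_freegT => [|p].
    exact: (subspace_preimage (linearP (comul PC)) sD).
  rewrite /wedge /preimage /= -[path_comul _]/(comul PC << p >>) comul_path.
  apply: (subspace_sum _ sD) => i.
  (* The cut vertex decides: if reachable, the suffix lies in [B]; otherwise the prefix lies in
     [A]. *)
  have [ai|nai] := pselect (reachable a (psrc (suffix_path p i))).
    exists (<< prefix_path p i >> \ox << suffix_path p i >>).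
      by apply: tensor_setT => //; apply: path_spanU.
    exists 0; rewrite ?addr0 //.
    by case/subspaceP: (span_subspace [set x \ox y | x in A & y in [set: PC]]).
  exists 0.
    by case/subspaceP: (span_subspace [set x \ox y | x in [set: PC] & y in B]).
  exists (<< prefix_path p i >> \ox << suffix_path p i >>); rewrite ?add0r //.
  by apply: tensor_setT => //; apply: path_spanU.
have trivial_path c : exists p : qpath G, psrc p = c /\ ptgt p = c.
  by exists (@QPath G (c, [::]) isT).
have [CA|CB] := primeC A B sA sB wAB.
  have [p [_ pa]] := trivial_path a.
  have : A << p >> by rewrite -CA.
  by move/span_freegU; apply; rewrite pa; exact: trivial_path.
have [p [pb _]] := trivial_path b.
have : B << p >> by rewrite -CB.
by move/span_freegU; rewrite pb.
Qed.

Lemma strongly_connected_prime :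
  strongly_connected G -> prime_coalgebra PC.
Proof.
move=> conn A B sA sB wAB; apply: contrapT => /not_orP[CA CB].
have [p Ap pmin] := shortest_path_notin sA.1 (nesym CA).
have [q Bq qmin] := shortest_path_notin sB.1 (nesym CB).
have [r [pr rq]] := conn (ptgt p) (psrc q).
have [w wlen [wp wr wq]] := join_paths (esym pr) rq.
have [f [fl fA fp]] := separating_functional sA.1 Ap.
have [g [gl gB gq]] := separating_functional sB.1 Bq.
pose h : PC -> k^o := coeff r.
have hl : linear h by move=> a x y; rewrite /h coeffD coeffZ.
have hgl := convolution_linear hl gl.
have : convolution f (convolution h g) << w >> = 0.
  apply: (convolution_wedge_eq0 fl hgl fA (convolution_eq0r hl gl sB gB)).
  by rewrite -wAB.
suff -> : convolution f (convolution h g) << w >> = 1.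
  by move/eqP; rewrite oner_eq0.
have hU s : h << s >> = (s == r)%:R by rewrite /h coeffU mul1r.
have hP s j : (j <= plength s)%N -> j != plength r -> h << prefix_path s j >> = 0.
  move=> js jr; rewrite hU; case: eqP => // e.
  by move: jr; rewrite -e plength_prefix ?eqxx.
rewrite convolution_path // (@sum_nat_only1 _ _ (plength p)) => [||i iw ip].
- rewrite wp fp mul1r convolution_path // (@sum_nat_only1 _ _ (plength r)).
  + by rewrite wr wq hU eqxx mul1r.
  + by rewrite ltnS plength_suffix wlen -addnA addKn leq_addr.
  + by move=> j js jr; rewrite hP ?mul0r.
- by rewrite ltnS wlen -addnA leq_addr.
(* A cut before the end of [p] leaves a prefix shorter than [p], hence in [A]. *)
- have [ltip|leip] := ltnP i (plength p).
    by rewrite fA ?mul0r //; apply: pmin; rewrite plength_prefix.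
  have {ip leip}ltpi : (plength p < i)%N by rewrite ltn_neqAle eq_sym ip.
  rewrite convolution_path // big1_seq ?mulr0 // => j /andP[_].
  rewrite mem_index_iota /= ltnS plength_suffix => jw.
  (* After a late first cut, [h] still forces a middle piece as long as [r], so the rest is shorter
     than [q] and lies in [B]. *)
  have [jr|jr] := eqVneq j (plength r); last by rewrite hP ?mul0r ?plength_suffix.
  rewrite gB ?mulr0 //; apply: qmin; rewrite !plength_suffix jr wlen in jw *.
  by move: iw jw; rewrite wlen; lia.
Qed.

End Paths.

Theorem theorem3p4 (k : fieldType) (G : quiver) :
  prime_coalgebra (path_coalgebra k G) <-> strongly_connected G.
Proof.
by split; [apply: prime_strongly_connected | apply: strongly_connected_prime].
Qed.
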